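(* Let $C$ be a complete set of diameter $1$ in a Minkowski space $(\mathbb{R}^n,\|\cdot\|)$, and let $K \subseteq C$ be a convex body. The following three conditions are equivalent: (I) $C$ is the unique completion of $K$. (II) $\operatorname{bh}_1(K)=C$. (III) $K$ meets every exposed b-face of $C$. If, in addition, $\|\cdot\|$ is strictly convex, then (I), (II), and (III) are equivalent to (IV) $\operatorname{cl}(\operatorname{conv}(\operatorname{b-exp}(C))) \subseteq K$.
   Context: A Minkowski space $(\mathbb{R}^n,\|\cdot\|)$ is $\mathbb{R}^n$, $n\ge 1$, equipped with an arbitrary norm; the norm is strictly convex if the boundary of the unit ball contains no segment $[x_1,x_2]$ with $x_1\neq x_2$. For $x\in\mathbb{R}^n$ and $r\ge 0$, $B(x,r)=\{y:\|y-x\|\le r\}$ is the closed ball and $S(x,r)=\{y:\|y-x\|=r\}$ the sphere; $\operatorname{cl}$ and $\operatorname{conv}$ denote closure and convex hull, and $\operatorname{diam}$ is the diameter with respect to $\|\cdot\|$. A convex body is a compact, convex, non-empty subset of $\mathbb{R}^n$ (it may have empty interior). A bounded non-empty set $C\subseteq\mathbb{R}^n$ is complete if $\operatorname{diam}(C\cup\{x\})>\operatorname{diam}(C)$ for every $x\in\mathbb{R}^n\setminus C$. A complete set $C$ is a completion of a bounded non-empty set $S$ if $S\subseteq C$ and $\operatorname{diam}(C)=\operatorname{diam}(S)$. The ball hull of $S\subseteq\mathbb{R}^n$ is $\operatorname{bh}_1(S)=\bigcap_{x\in\mathbb{R}^n:\,S\subseteq B(x,1)}B(x,1)$, where the intersection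 of an empty family is $\mathbb{R}^n$. A set $S$ is b-convex if $S=\operatorname{bh}_1(S)$; a b-convex body is a bounded non-empty b-convex set. (A complete set of diameter $1$ is a b-convex body.) A supporting sphere of a b-convex body $C$ is a sphere $S(x,1)$ of radius $1$ with $C\subseteq B(x,1)$ and $C\cap S(x,1)\neq\emptyset$; the set $C\cap S(x,1)$ is then called an exposed b-face of $C$. If an exposed b-face is a singleton $\{x_0\}$, then $x_0$ is a b-exposed point of $C$; $\operatorname{b-exp}(C)$ is the set of all b-exposed points of $C$. *)

(* Defs.v *)
From mathcomp Require Import all_boot all_order all_algebra.
From mathcomp Require Import all_classical all_reals all_analysis.
Set Implicit Arguments.
Unset Strict Implicit.
Unset Printing Implicit Defensive.
Import Order.TTheory GRing.Theory Num.Theory numFieldNormedType.Exports.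
Local Open Scope classical_set_scope.
Local Open Scope ring_scope.

(* The Minkowski space is 'rV[R]_n together with an arbitrary norm N.  The
   ambient library norm `|.| on 'rV[R]_n is the maximum norm; it is used only
   through the topology it induces (compact, closure, interior), which is the
   usual topology of R^n and hence the topology of every N.  All metric notions
   below refer to N. *)
Record is_norm (R : realType) (n : nat) (N : 'rV[R]_n -> R) : Prop := IsNorm {
  norm_ge0 : forall x, 0 <= N x;
  norm_eq0 : forall x, N x = 0 -> x = 0;
  normZ : forall (a : R) x, N (a *: x) = `|a| * N x;
  norm_triangle : forall x y, N (x + y) <= N x + N y
}.

Section Minkowski.
Variables (R : realType) (n : nat) (N : 'rV[R]_n -> R).
Local Notation V := 'rV[R]_n.
Implicit Types (x y : V) (r : R) (A C F K S : set V).

Definition mball x r : set V := closed_ball_ N x r.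

Definition msphere x r : set V := [set y | N (x - y) = r].

Definition segment x y : set V :=
  [set (1 - t) *: x + t *: y | t in `[0, 1]].

Definition boundary A : set V := closure A `\` interior A.

Definition strictly_convex : Prop :=
  forall x y, x != y -> ~ (segment x y `<=` boundary (mball 0 1)).

Definition mbounded A : Prop := exists M : R, forall x, A x -> N x <= M.

(* Extended-real valued, so that unbounded sets have diameter +oo. *)
Definition diam A : \bar R :=
  ereal_sup [set (N (x - y))%:E | x in A & y in A].

Definition conv_hull A : set V := smallest (@convex_set R V) A.

Definition convex_body K : Prop :=
  [/\ compact K, convex_set K & K !=set0].

Definition complete_set C : Prop :=
  [/\ mbounded C, C !=set0 &
      forall x, ~ C x -> (diam C < diam (C `|` [set x]))%E].

Definition completion S C : Prop :=
  [/\ complete_set C, S `<=` C & diam C = diam S].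

Definition unique_completion S C : Prop :=
  completion S C /\ forall C', completion S C' -> C' = C.

Definition ball_hull S : set V :=
  \bigcap_(x in [set x | S `<=` mball x 1]) mball x 1.

(* The sphere of radius 1 with center x is a supporting sphere of C. *)
Definition supporting_center C x : Prop :=
  C `<=` mball x 1 /\ C `&` msphere x 1 !=set0.

Definition exposed_bface C F : Prop :=
  exists2 x, supporting_center C x & F = C `&` msphere x 1.

Definition b_exp C : set V := [set x | exposed_bface C [set x]].

End Minkowski.

(* Main.v *)
Require Import Defs.
From mathcomp Require Import all_boot all_order all_algebra.
From mathcomp Require Import all_classical all_reals all_analysis.
From mathcomp Require Import ring lra.
Import Order.TTheory GRing.Theory Num.Theory numFieldNormedType.Exports.
Local Open Scope classical_set_scope.
Local Open Scope ring_scope.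

(** Everything rests on one property of a complete set [C] of diameter 1: it is
    its own polar for unit balls, i.e. [x] lies in [C] exactly when the unit ball
    around [x] contains [C] ([complete_self_dual]).  Hence supporting centres of
    [C] are points of [C], and an exposed b-face is the set of all diametral
    partners of some point [x] of [C] that has one.  So (III) says that every
    such [x] has a partner in [K] ([diametral_partners]), and (II) says that
    every unit ball containing [K] has its centre in [C] ([ball_hull_eqP]).

    (I) and (II).  If the unit ball around [x] contains [K] and [K] has diameter
    1, then so does [K] with [x] added, and Zorn's lemma puts both into a
    complete set of diameter 1; uniqueness makes it [C], so [x] is in [C].
    Conversely, any completion is contained in [C] by (II), and two complete sets
    of the same diameter are never properly nested.  That [K] has diameter 1
    comes from (III): replace both ends of a diametral pair of [C], one after the
    other, by points of [K].

    (II) and (III).  If [x] has a partner [y] in [C] but none in the compact set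
    [K], then moving [x] slightly away from [y] keeps [K] inside the unit ball
    and expels [y].  Conversely, let the unit ball around [w] contain [K] and
    suppose that [w] is outside [C].  There is a point [c] of [C] at distance at
    most [r < 1] from all of [C] ([deep_point]), and the segment from [c] to [w]
    leaves [C] at a point [b] with a diametral partner ([segment_crossing]),
    hence with a partner [k] in [K].  Convexity of the distance to [k] along the
    segment gives distance less than 1 at [b], a contradiction.

    (III) and (IV).  A b-exposed point is a one-point face, so (III) puts it into
    [K].  Conversely, by compactness of [K] it is enough to find, for each [x]
    with a diametral partner, b-exposed points at distance nearly 1 from [x]
    ([b_exp_near_face]).  These come from smooth boundary points of [C]: if a
    Euclidean ball inside [C] touches the boundary at [x'], then every unit ball
    containing [C] with [x'] on its sphere has the tangent hyperplane of the
    Euclidean ball as a supporting hyperplane at [x'], and strict convexity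
    leaves room for only one such unit ball; its centre is the only partner of
    [x'], hence b-exposed ([smooth_point_b_exp]).  The largest Euclidean ball in
    [C] around a point near [x] touches the boundary near [x]. *)

(** * Norms on row vectors *)

Section NormTheory.
Set Implicit Arguments.
Unset Strict Implicit.
Variables (R : realType) (n : nat) (N : 'rV[R]_n -> R).
Hypothesis hN : is_norm N.
Local Notation V := 'rV[R]_n.
Implicit Types x y z u v : V.

Lemma norm0 : N 0 = 0.
Proof. by rewrite -(scale0r 0) (normZ hN) normr0 mul0r. Qed.

Lemma normN x : N (- x) = N x.
Proof. by rewrite -scaleN1r (normZ hN) normrN1 mul1r. Qed.

Lemma normBC x y : N (x - y) = N (y - x).
Proof. by rewrite -normN opprB. Qed.

Lemma norm_dist_triangle y x z : N (x - z) <= N (x - y) + N (y - z).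
Proof. by have := norm_triangle hN (x - y) (y - z); rewrite addrA subrK. Qed.

Lemma norm_sum (I : Type) (s : seq I) (F : I -> V) :
  N (\sum_(i <- s) F i) <= \sum_(i <- s) N (F i).
Proof.
elim: s => [|i s IHs]; first by rewrite !big_nil norm0.
by rewrite !big_cons (le_trans (norm_triangle hN _ _))// lerD2l.
Qed.

Lemma norm_convex (t : R) x y z : 0 <= t -> t <= 1 ->
  N ((1 - t) *: x + t *: y - z) <= (1 - t) * N (x - z) + t * N (y - z).
Proof.
move=> t0 t1; have -> : (1 - t) *: x + t *: y - z =
    (1 - t) *: (x - z) + t *: (y - z).
  by apply/rowP => i; rewrite !mxE; ring.
rewrite (le_trans (norm_triangle hN _ _))// !(normZ hN) !ger0_norm//.
by rewrite subr_ge0.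
Qed.

Definition coord_norm_sum : R := \sum_i N (delta_mx 0 i).

Lemma coord_norm_sum_ge0 : 0 <= coord_norm_sum.
Proof. by apply: sumr_ge0 => i _; exact: norm_ge0. Qed.

Lemma norm_le_coord (a : R) v : (forall i, `|v 0 i| <= a) ->
  N v <= coord_norm_sum * a.
Proof.
move=> va; rewrite {1}(row_sum_delta v) (le_trans (norm_sum _ _))//.
rewrite /coord_norm_sum mulr_suml ler_sum// => i _.
by rewrite (normZ hN) mulrC ler_wpM2l ?(norm_ge0 hN).
Qed.

Lemma norm_le_max v : N v <= coord_norm_sum * `|v|.
Proof.
apply: norm_le_coord => i.
rewrite [X in _ <= X]mx_normrE.
exact: (le_bigmax _ (fun ij : 'I_1 * 'I_n => `|v ij.1 ij.2|) (0, i)).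
Qed.

Lemma norm_lipschitz x y : `|N x - N y| <= N (x - y).
Proof.
have := norm_triangle hN (x - y) y; have := norm_triangle hN (y - x) x.
rewrite !subrK (normBC y) => h1 h2.
by rewrite ler_norml; apply/andP; split; lra.
Qed.

Lemma is_norm_continuous : continuous N.
Proof.
move=> x; apply/(@cvgrPdist_le _ _ _ _ (nbhs_filter x)) => e e0.
have d0 : 0 < e / (coord_norm_sum + 1).
  by rewrite divr_gt0// ltr_wpDl// coord_norm_sum_ge0.
near=> y.
rewrite (le_trans (norm_lipschitz _ _))// (le_trans (norm_le_max _))//.
have xy : `|x - y| <= e / (coord_norm_sum + 1).
  near: y.
  by apply: (@cvgr_dist_le _ _ _ (nbhs x) _ id x) => //; exact: cvg_id.
have L0 := coord_norm_sum_ge0.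
move: xy; rewrite ler_pdivlMr ?ltr_wpDl// => xy.
rewrite (le_trans _ xy)// mulrC ler_wpM2l// lerDl ler01.
by [].
Unshelve. all: by end_near. Qed.

Lemma dist_continuous2 : continuous (fun p : V * V => N (p.1 - p.2)).
Proof.
move=> p; apply: (continuous_comp (f := fun p : V * V => p.1 - p.2)); last first.
  exact: is_norm_continuous.
by apply: (@cvgB _ _ _ (nbhs p)); [exact: cvg_fst|exact: cvg_snd].
Qed.

Lemma dist_continuous x : continuous (fun y => N (x - y)).
Proof.
move=> y; apply: (continuous_comp (f := fun y => x - y)); last first.
  exact: is_norm_continuous.
by apply: (@cvgB _ _ _ (nbhs y)); [exact: cvg_cst|exact: cvg_id].
Qed.

(** The minimum of [N] on the unit sphere of the maximum norm is positive, by
    compactness; with [norm_le_max] this makes [N] induce the usual topology. *)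
Lemma norm_ge_max : exists2 c, 0 < c & forall v, c * `|v| <= N v.
Proof.
pose S := [set v : V | `|v| = 1].
have [S0|/negP S0] := boolP `[< S !=set0 >]; last first.
  exists 1 => // v; have [->|v0] := eqVneq v 0.
    by rewrite normr0 mulr0 (norm_ge0 hN).
  exfalso; apply: S0; apply/asboolP; exists (`|v|^-1 *: v).
  by rewrite /S/= normrZ normfV normr_id mulVf// normr_eq0.
move/asboolP in S0.
have cS : compact S.
  apply: bounded_closed_compact.
    exists 1; split=> // M M1 v /= ->; exact: ltW.
  apply: (@preimage_closed _ _ (fun v : V => `|v|) [set x : R | x = 1]).
    by move=> ? _; exact: @norm_continuous.
  exact: closed_eq.
have [v0 v0S v0min] := EVT_min_rV S0 cS (continuous_subspaceT is_norm_continuous).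
rewrite inE in v0S.
exists (N v0) => [|v].
  rewrite lt_neqAle (norm_ge0 hN) andbT eq_sym; apply/eqP => /(norm_eq0 hN) v00.
  by move: v0S; rewrite /S/= v00 normr0 => /eqP; rewrite eq_sym oner_eq0.
have [->|vn0] := eqVneq v 0; first by rewrite normr0 mulr0 (norm_ge0 hN).
have v_gt0 : 0 < `|v| by rewrite normr_gt0.
have := v0min (`|v|^-1 *: v).
rewrite inE /S/= normrZ normfV normr_id mulVf ?gt_eqF// => /(_ erefl).
by rewrite (normZ hN) normfV normr_id ler_pdivlMl// mulrC.
Qed.

Lemma closed_mball x (r : R) : closed (mball N x r).
Proof.
apply: (@preimage_closed _ _ (fun y => N (x - y)) [set s : R | s <= r]).
  by move=> y _; exact: dist_continuous.
exact: closed_le.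
Qed.

Lemma compact_mball x (r : R) : compact (mball N x r).
Proof.
apply: bounded_closed_compact; last exact: closed_mball.
have [c c0 cN] := norm_ge_max.
exists ((N x + r) / c); split=> [|M rM y /= xy]; first exact: num_real.
rewrite (le_trans _ (ltW rM))// ler_pdivlMr// mulrC (le_trans (cN _))//.
have := norm_dist_triangle x 0 y; rewrite !sub0r !normN => /le_trans; apply.
by rewrite lerD2l.
Qed.

Lemma farthest_point (A : set V) x : compact A -> A !=set0 ->
  exists2 a, A a & forall b, A b -> N (x - b) <= N (x - a).
Proof.
move=> cA A0.
have [a aA amax] :=
  EVT_max_rV A0 cA (continuous_subspaceT (@dist_continuous x)).
exists a => [|b bA]; first by rewrite inE in aA.
by apply: amax; rewrite inE.
Qed.

End NormTheory.

(** * Diameter and complete sets *)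

Section Completeness.
Set Implicit Arguments.
Unset Strict Implicit.
Variables (R : realType) (n : nat) (N : 'rV[R]_n -> R).
Hypothesis hN : is_norm N.
Local Notation V := 'rV[R]_n.
Implicit Types (x y : V) (A S : set V).

Lemma diam_le A (d : R) :
  (forall x y, A x -> A y -> N (x - y) <= d) -> (diam N A <= d%:E)%E.
Proof.
by move=> Ad; apply: ge_ereal_sup => _ [x Ax [y Ay <-]]; rewrite lee_fin Ad.
Qed.

Lemma le_diam A x y : A x -> A y -> ((N (x - y))%:E <= diam N A)%E.
Proof. by move=> Ax Ay; apply: ereal_sup_ubound; exists x => //; exists y. Qed.

Lemma subset_diam S A : S `<=` A -> (diam N S <= diam N A)%E.
Proof.
move=> SA; apply: le_ereal_sup => _ [x Sx [y Sy <-]].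
by exists x; [exact: SA|exists y => //; exact: SA].
Qed.

Lemma diam_eq A (d : R) x y :
  (forall x y, A x -> A y -> N (x - y) <= d) -> A x -> A y -> N (x - y) = d ->
  diam N A = d%:E.
Proof.
move=> Ad Ax Ay xyd; apply/eqP; rewrite eq_le diam_le//=.
by rewrite -xyd le_diam.
Qed.

Lemma diam1_le A x y : diam N A = 1%:E -> A x -> A y -> N (x - y) <= 1.
Proof. by move=> dA Ax Ay; rewrite -lee_fin -dA le_diam. Qed.

(** A point within distance 1 of all of [A] can be added without increasing the
    diameter, so completeness puts it into [A]. *)
Lemma complete_self_dual A : complete_set N A -> diam N A = 1%:E ->
  forall x, A x <-> A `<=` mball N x 1.
Proof.
move=> [_ _ hA] dA x; split=> [Ax y Ay|Ax]; first exact: diam1_le dA Ax Ay.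
apply: contrapT => nAx; have := hA _ nAx; rewrite dA ltNge => /negP; apply.
apply: diam_le => y z [Ay|->] [Az|->].
- exact: diam1_le dA Ay Az.
- by rewrite (normBC hN); exact: Ax.
- exact: Ax.
- by rewrite subrr (norm0 hN).
Qed.

(** A maximal set of diameter at most 1 containing [S] is complete. *)
Lemma exists_complete_superset S : S !=set0 ->
  (forall x y, S x -> S y -> N (x - y) <= 1) -> diam N S = 1%:E ->
  exists2 A, complete_set N A & S `<=` A /\ diam N A = 1%:E.
Proof.
move=> [s Ss] S1 dS.
(* [S] is joined to [A] inside [P] because Zorn's lemma is applied to all sets,
   and the union of the empty chain does not contain [S]. *)
pose P A := forall x y, (A `|` S) x -> (A `|` S) y -> N (x - y) <= 1.
have [F FP Ftot|A [PA Amax]] := @Zorn_bigcup V P.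
  move=> x y [[X FX Xx]|Sx] [[Y FY Yy]|Sy].
  - have [XY|YX] := Ftot _ _ FX FY.
      by apply: (FP _ FY); left=> //; exact: XY.
    by apply: (FP _ FX); left=> //; exact: YX.
  - by apply: (FP _ FX); [left|right].
  - by apply: (FP _ FY); [right|left].
  - exact: S1.
have SA : S `<=` A.
  apply: contrapT => nSA; apply: (Amax (A `|` S)).
    split; first exact: subsetUl.
    by move=> SA; apply: nSA => z Sz; apply: SA; right.
  by move=> x y; rewrite -setUA setUid; exact: PA.
have dA : diam N A = 1%:E.
  apply/eqP; rewrite eq_le diam_le /=; last first.
    by move=> x y Ax Ay; apply: PA; left.
  by rewrite -dS subset_diam.
exists A => //; split.
- exists (1 + N s) => x Ax.
  have := norm_triangle hN (x - s) s; rewrite subrK => /le_trans; apply.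
  by rewrite lerD2r; apply: PA; left=> //; exact: SA.
- by exists s; exact: SA.
- move=> x nAx; rewrite dA ltNge; apply/negP => dx.
  apply: (Amax (A `|` [set x])).
    by split; [exact: subsetUl|move=> xA; apply: nAx; apply: xA; right].
  have AxS : (A `|` [set x]) `|` S = A `|` [set x].
    by apply/setUidPl => z /SA; left.
  move=> y z; rewrite AxS => Ay Az.
  by rewrite -lee_fin (le_trans _ dx)// le_diam.
Qed.

End Completeness.

(** * Sets that are their own unit-ball polar *)

Section SelfDual.
Set Implicit Arguments.
Unset Strict Implicit.
Variables (R : realType) (n : nat) (N : 'rV[R]_n -> R).
Hypothesis hN : is_norm N.
Local Notation V := 'rV[R]_n.
Variable C : set V.
Hypothesis C0 : C !=set0.
Hypothesis CP : forall x, C x <-> C `<=` mball N x 1.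
Implicit Types (x y : V) (K S : set V).

Lemma self_dual_le x y : C x -> C y -> N (x - y) <= 1.
Proof. by move=> /CP Cx /Cx. Qed.

Lemma self_dual_compact : compact C.
Proof.
have [c Cc] := C0.
apply: (subclosed_compact _ (@compact_mball _ _ _ hN c 1)); last exact/CP.
rewrite (_ : C = \bigcap_(x in C) mball N x 1).
  by apply: closed_bigI => x _; exact: closed_mball.
apply/seteqP; split=> [x Cx y Cy|x Cx]; first by move/CP: Cy; exact.
by apply/CP => y Cy; rewrite /mball /closed_ball_ /= (normBC hN); exact: Cx.
Qed.

Lemma exists_diametral_pair : diam N C = 1%:E ->
  exists x y, [/\ C x, C y & N (x - y) = 1].
Proof.
move=> dC; have [c Cc] := C0.
have CC0 : C `*` C !=set0 by exists (c, c).
have fC := continuous_subspaceT (A := C `*` C) (dist_continuous2 hN).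
have [[x y]] :=
  compact_EVT_max CC0 (compact_setX self_dual_compact self_dual_compact) fC.
rewrite inE => -[/= Cx Cy] xymax; exists x, y; split=> //.
apply/eqP; rewrite eq_le self_dual_le//= -lee_fin -dC.
by apply: diam_le => a b Ca Cb; apply: (xymax (a, b)); rewrite inE.
Qed.

(** The averaging estimate for [deep_point]: one term at most 1/2, the others at
    most 1. *)
Lemma sum_le_size_half (s : seq V) (F : V -> R) i :
  (forall j, j \in s -> F j <= 1) -> i \in s -> F i <= 2^-1 ->
  \sum_(j <- s) F j <= (size s)%:R - 2^-1.
Proof.
move=> F1 si Fi; rewrite (big_rem i)//=.
have : \sum_(j <- rem i s) F j <= \sum_(j <- rem i s) 1.
  by rewrite !big_seq ler_sum// => j /mem_rem; exact: F1.
rewrite big_const_seq count_predT iter_addr_0 size_rem// => h.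
rewrite (le_trans (lerD Fi h))//.
case: (s) si => // a l _ /=; rewrite -[(size l).+1]addn1 natrD.
by lra.
Qed.

(** The centre is the barycentre of a finite 1/2-net of [C]: each point [p] of [C]
    is within 1/2 of one point of the net and within 1 of the others, so its
    distance to the barycentre is less than 1, uniformly in [p]. *)
Lemma deep_point : exists c r, r < 1 /\ forall p, C p -> N (c - p) <= r.
Proof.
have [c0 Cc0] := C0.
have := self_dual_compact; rewrite compact_cover.
move=> /(_ _ C (fun x => [set y | N (x - y) < 2^-1]))[x _||D DC CD].
- apply: (@open_comp _ _ (fun y => N (x - y)) [set s : R | s < 2^-1]).
    by move=> y _; exact: dist_continuous.
  exact: open_lt.
- by move=> x Cx; exists x => //=; rewrite subrr (norm0 hN) invr_gt0 ltr0n.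
pose s : seq V := finmap.enum_fset D.
have sC x : x \in s -> C x by move=> /DC; rewrite inE.
have s_gt0 : 0 < (size s)%:R :> R.
  have [x /= Dx _] := CD _ Cc0.
  by rewrite ltr0n; move: Dx; rewrite -[_ \in _]/(x \in s); case: (s).
exists ((size s)%:R^-1 *: \sum_(i <- s) i), (1 - (size s)%:R^-1 * 2^-1).
split=> [|p Cp]; first by rewrite ltrBlDr ltrDl mulr_gt0// invr_gt0.
have [i /= si ip] := CD _ Cp.
have -> : (size s)%:R^-1 *: (\sum_(i <- s) i) - p =
    (size s)%:R^-1 *: \sum_(i <- s) (i - p).
  rewrite sumrB scalerBr big_const_seq count_predT iter_addr_0.
  by rewrite -(scaler_nat _ p) scalerA mulVf ?gt_eqF// scale1r.
rewrite (normZ hN) ger0_norm ?invr_ge0 ?(ltW s_gt0)//.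
rewrite -[X in _ <= X - _](@mulVf _ (size s)%:R) ?gt_eqF//.
rewrite -mulrBr ler_wpM2l ?invr_ge0 ?(ltW s_gt0)//.
rewrite (le_trans (norm_sum hN _ _))// (@sum_le_size_half _ _ i)//;
  last exact: ltW.
by move=> j /sC Cj; exact: self_dual_le.
Qed.

(** The farthest point of [C] from [b] is at distance less than 1, so all points
    near [b] are still within 1 of [C], hence in [C]. *)
Lemma self_dual_room b : C b -> (forall p, C p -> N (b - p) < 1) ->
  exists2 e, 0 < e & forall x, N (x - b) <= e -> C x.
Proof.
move=> Cb b1.
have [a Ca amax] := @farthest_point _ _ _ hN _ b self_dual_compact C0.
exists (1 - N (b - a)) => [|x xb]; first by rewrite subr_gt0 b1.
apply/CP => p Cp; rewrite /mball /closed_ball_ /=.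
have := @norm_dist_triangle _ _ _ hN b x p; have := amax _ Cp; lra.
Qed.

(** At the last point of the segment in [C], the lack of a diametral partner would
    leave room to go further, by [self_dual_room]. *)
Lemma segment_crossing z w : C z -> ~ C w ->
  exists t, [/\ 0 <= t, t < 1, C ((1 - t) *: z + t *: w) &
    exists2 p, C p & N ((1 - t) *: z + t *: w - p) = 1].
Proof.
move=> Cz nCw.
pose l (t : R) := (1 - t) *: z + t *: w.
have cl : continuous l.
  move=> t; apply: (@cvgD _ _ _ (nbhs t)).
    apply: (@cvgZr_tmp _ _ _ (nbhs t)).
    by apply: (@cvgB _ _ _ (nbhs t)); [exact: cvg_cst|exact: cvg_id].
  by apply: (@cvgZr_tmp _ _ _ (nbhs t)); exact: cvg_id.
have lE s t : l s - l t = (s - t) *: (w - z).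
  by apply/rowP => i; rewrite !mxE; ring.
pose T := `[0, 1]%classic `&` (l @^-1` C).
have cT : compact T.
  apply: compact_closedI; first exact: segment_compact.
  apply: preimage_closed; first by move=> t _; exact: cl.
  by apply: (compact_closed _ self_dual_compact); exact: norm_hausdorff.
have T0 : T !=set0.
  exists 0; split; first by rewrite /= in_itv/= lexx ler01.
  by rewrite /= /l subr0 scale1r scale0r addr0.
have idc : {within T, continuous (@id R)}.
  by apply: continuous_subspaceT => t; exact: cvg_id.
have [t] := compact_EVT_max T0 cT idc.
rewrite inE => -[/=]; rewrite in_itv/= => /andP[t0 t1] Clt tmax.
have {}t1 : t < 1.
  rewrite lt_neqAle t1 andbT; apply/eqP => tE; apply: nCw.
  by move: Clt; rewrite tE /l subrr scale0r scale1r add0r.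
exists t; split=> //; apply: contrapT => nb.
have [|e e0 he] := self_dual_room Clt.
  move=> p Cp; rewrite lt_neqAle self_dual_le// andbT.
  by apply/eqP => tp; apply: nb; exists p.
have d0 : 0 < N (w - z) + 1 by rewrite ltr_wpDl// (norm_ge0 hN).
(* a step that stays in the segment and moves the point by at most [e]; adding 1
   to the denominator avoids a division by zero *)
pose h := Num.min (1 - t) (e / (N (w - z) + 1)).
have h0 : 0 < h by rewrite lt_min subr_gt0 t1 divr_gt0.
have h1 : h <= 1 - t by rewrite ge_min lexx.
have he1 : h * (N (w - z) + 1) <= e by rewrite -ler_pdivlMr// ge_min lexx orbT.
have : t + h <= t; last by lra.
apply: tmax; rewrite inE; split.
  by rewrite /= in_itv/=; apply/andP; split; lra.
apply: he; rewrite lE (normZ hN) addrC addKr ger0_norm ?(ltW h0)//.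
by rewrite (le_trans _ he1)// ler_wpM2l ?(ltW h0)// lerDl.
Qed.

(** Condition (III) without faces, see [meets_faces_partners]. *)
Definition diametral_partners K :=
  forall x y, C x -> C y -> N (x - y) = 1 -> exists2 k, K k & N (x - k) = 1.

(** The supporting centres of [C] are the points of [C] that have a diametral
    partner in [C], because [C] is its own polar. *)
Lemma meets_faces_partners K : K `<=` C ->
  (forall F, exposed_bface N C F -> K `&` F !=set0) <-> diametral_partners K.
Proof.
move=> KC; split=> [KF x y Cx Cy xy|Kp F [x [Cx [y [Cy xy]]] ->]].
  have [|k [Kk [_ xk]]] := KF (C `&` msphere N x 1); last by exists k.
  by exists x => //; split; [exact/CP|exists y].
have [k Kk xk] := Kp x y ((CP x).2 Cx) Cy xy.
by exists k; split=> //; split=> //; exact: KC.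
Qed.

Lemma ball_hull_sub K : K `<=` C -> ball_hull N K `<=` C.
Proof.
move=> KC x Kx; apply/CP => y Cy; rewrite /mball /closed_ball_ /= (normBC hN).
by apply: Kx => z /KC Cz; exact: self_dual_le.
Qed.

Lemma ball_hull_eqP K : K `<=` C ->
  ball_hull N K = C <-> (forall x, K `<=` mball N x 1 -> C x).
Proof.
move=> KC; split=> [KE x Kx|Kx].
  by apply/CP => y; rewrite -KE => /(_ x Kx).
apply/seteqP; split=> [|y Cy x /= /Kx Cx]; first exact: ball_hull_sub.
exact: self_dual_le.
Qed.

(** If [K] stayed within distance [1 - e] of [x], then shifting [x] by [e] away from
    its partner [y] would give a unit ball that contains [K] but not [y]. *)
Lemma partners_of_ball_hull K : compact K -> K !=set0 ->
  K `<=` C -> ball_hull N K = C -> diametral_partners K.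
Proof.
move=> cK K0 KC KE x y Cx Cy xy.
have [k Kk kmax] := @farthest_point _ _ _ hN _ x cK K0.
exists k => //; apply/eqP; rewrite eq_le self_dual_le//=; last exact: KC.
rewrite leNgt; apply/negP => k1.
pose e := 1 - N (x - k).
have e0 : 0 < e by rewrite subr_gt0.
pose x' := x + e *: (x - y).
have Kx' : K `<=` mball N x' 1.
  move=> p Kp; rewrite /mball /closed_ball_ /=.
  have := norm_triangle hN (x - p) (e *: (x - y)).
  have -> : x - p + e *: (x - y) = x' - p.
    by apply/rowP => i; rewrite !mxE; ring.
  rewrite (normZ hN) xy mulr1 ger0_norm ?(ltW e0)// => /le_trans; apply.
  by have := kmax _ Kp; rewrite /e; lra.
have : N (x' - y) <= 1.
  by apply: self_dual_le => //; exact: ((ball_hull_eqP KC).1 KE).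
have -> : x' - y = (1 + e) *: (x - y).
  by apply/rowP => i; rewrite !mxE; ring.
rewrite (normZ hN) xy mulr1 ger0_norm; last by lra.
by rewrite gerDl leNgt e0.
Qed.

(** The distance to [k] is at most [r < 1] at the deep point [c], at most 1 at [w]
    and convex in between, so it cannot be 1 at the crossing point. *)
Lemma ball_hull_of_partners K : K `<=` C -> diametral_partners K ->
  ball_hull N K = C.
Proof.
move=> KC Kp; apply/ball_hull_eqP => // w Kw; apply: contrapT => nCw.
have [c [r [r1 cr]]] := deep_point.
have Cc : C c by apply/CP => p Cp; apply: le_trans (ltW r1); exact: cr.
have [t [t0 t1 Cb [p Cp bp]]] := segment_crossing Cc nCw.
have [k Kk] := Kp _ _ Cb Cp bp.
have := @norm_convex _ _ _ hN t c w k t0 (ltW t1).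
have := cr _ (KC _ Kk); have := Kw _ Kk; rewrite /mball /closed_ball_ /=.
nra.
Qed.

End SelfDual.

(** * Euclidean tangency and b-exposed points *)

Section Euclid.
Set Implicit Arguments.
Unset Strict Implicit.
Variables (R : realType) (n : nat).
Local Notation V := 'rV[R]_n.
Implicit Types (e u v w x y z : V).

Definition dotv u v : R := (u *m v^T) 0 0.

Lemma dotvE u v : dotv u v = \sum_i u 0 i * v 0 i.
Proof. by rewrite /dotv mxE; apply: eq_bigr => i _; rewrite mxE. Qed.

Lemma dotvC u v : dotv u v = dotv v u.
Proof. by rewrite !dotvE; apply: eq_bigr => i _; rewrite mulrC. Qed.

Lemma dotvDl u v w : dotv (u + v) w = dotv u w + dotv v w.
Proof. by rewrite /dotv mulmxDl mxE. Qed.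

Lemma dotvZl (a : R) u w : dotv (a *: u) w = a * dotv u w.
Proof. by rewrite /dotv -scalemxAl mxE. Qed.

Lemma dotvDr u v w : dotv w (u + v) = dotv w u + dotv w v.
Proof. by rewrite !(dotvC w) dotvDl. Qed.

Lemma dotvZr (a : R) u w : dotv w (a *: u) = a * dotv w u.
Proof. by rewrite !(dotvC w) dotvZl. Qed.

Lemma coord_sqr_le v i : (v 0 i) ^+ 2 <= dotv v v.
Proof.
rewrite dotvE (bigD1 i)//= expr2 lerDl sumr_ge0// => j _.
by rewrite -expr2 sqr_ge0.
Qed.

Lemma dotv_ge0 v : 0 <= dotv v v.
Proof. by rewrite dotvE sumr_ge0// => j _; rewrite -expr2 sqr_ge0. Qed.

Lemma dotv_gt0 v : v != 0 -> 0 < dotv v v.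
Proof.
apply: contra_neqT; rewrite -leNgt => v0; apply/rowP => i; rewrite mxE.
by apply/eqP; rewrite -sqrf_eq0 eq_le sqr_ge0 (le_trans (coord_sqr_le _ _)).
Qed.

Lemma sqr_dist_continuous z : continuous (fun x => dotv (x - z) (x - z)).
Proof.
rewrite (_ : (fun _ => _) =
  (fun x : V => \sum_i (x 0 i - z 0 i) * (x 0 i - z 0 i))); last first.
  by apply/funext => x; rewrite dotvE; apply: eq_bigr => i _; rewrite !mxE.
move=> x; apply: (@cvg_big _ _ _ _ _ _ _ (nbhs x)); first exact: add_continuous.
move=> i _; apply: (@cvgM _ _ (nbhs x));
  by apply: (@cvgB _ _ _ (nbhs x)); [exact: coord_continuous|exact: cvg_cst].
Qed.

(** The tangent cone at [e] of the Euclidean ball with centre 0 and [e] on its sphere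
    contains the open half-space [dotv w e < 0]. *)
Lemma half_space_tangent e w : dotv w e < 0 ->
  exists2 t : R, 0 < t & dotv (e + t *: w) (e + t *: w) <= dotv e e.
Proof.
move=> we; have w0 := dotv_ge0 w.
have w1 : 0 < dotv w w + 1 by rewrite ltr_wpDl.
exists (- dotv w e / (dotv w w + 1)).
  by rewrite divr_gt0// oppr_gt0.
set t := _ / _; have t0 : 0 < t by rewrite divr_gt0// oppr_gt0.
have tw : t * (dotv w w + 1) = - dotv w e by rewrite mulfVK// gt_eqF.
rewrite !(dotvDl, dotvDr, dotvZl, dotvZr) (dotvC e w).
nra.
Qed.

Variable N : V -> R.
Hypothesis hN : is_norm N.

(** If some [v] of the unit ball were beyond the hyperplane, then a direction [w]
    close to [u - v] and slightly pushed along [u] would still point into the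
    half-space, and [u] would be a convex combination of [v] and [u + t *: w]
    scaled by a factor less than 1, so [N u < 1]. *)
Lemma tangent_support e u : N u = 1 ->
  (forall w, dotv w e < 0 -> exists2 t, 0 < t & N (u + t *: w) <= 1) ->
  forall v, N v <= 1 -> dotv v e <= dotv u e.
Proof.
move=> u1 ue v v1; rewrite leNgt; apply/negP => uv.
have a0 : 0 < `|dotv u e| + 1 by rewrite ltr_wpDl.
(* any [d] small enough that [w] below satisfies [dotv w e < 0] *)
pose d := (dotv v e - dotv u e) / (`|dotv u e| + 1).
have d0 : 0 < d by rewrite divr_gt0// subr_gt0.
have dE : d * (`|dotv u e| + 1) = dotv v e - dotv u e.
  by rewrite mulfVK// gt_eqF.
have [|t t0 ht] := ue (d *: u + (-1) *: (v + (-1) *: u)).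
  rewrite !(dotvDl, dotvZl).
  have := ler_norm (dotv u e); nra.
have := norm_triangle hN (u + t *: (d *: u + (-1) *: (v + (-1) *: u))) (t *: v).
have -> : u + t *: (d *: u + (-1) *: (v + (-1) *: u)) + t *: v =
    (1 + t + t * d) *: u.
  by apply/rowP => i; rewrite !mxE; ring.
have td : 0 < t * d by rewrite mulr_gt0.
rewrite !(normZ hN) u1 mulr1 ger0_norm; last by lra.
rewrite (ger0_norm (ltW t0)).
nra.
Qed.

Lemma sphere_boundary x : N x = 1 -> boundary (mball N 0 1) x.
Proof.
move=> x1; split.
  by apply: subset_closure; rewrite /mball /closed_ball_ /= sub0r (normN hN) x1.
move=> /nbhs_ballP[r /= r0 xr].
have a0 : 0 < `|x| + 1 by rewrite ltr_wpDl.
pose t := r / (`|x| + 1).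
have t0 : 0 < t by rewrite divr_gt0.
have : mball N 0 1 (x + t *: x).
  apply: xr; rewrite -ball_normE /ball_ /= opprD addrA subrr sub0r normrN normrZ.
  by rewrite gtr0_norm// /t -mulrA gtr_pMr// mulrC ltr_pdivrMr// mul1r ltrDl.
rewrite /mball /closed_ball_ /= sub0r (normN hN).
have -> : x + t *: x = (1 + t) *: x by rewrite scalerDl scale1r.
rewrite (normZ hN) x1 mulr1 ger0_norm; last by lra.
by lra.
Qed.

(** A linear form is constant on the segment between two of its maximizers over the
    unit ball, so the whole segment lies on the unit sphere. *)
Lemma strictly_convex_support e u1 u2 : strictly_convex N -> e != 0 ->
  N u1 = 1 -> N u2 = 1 ->
  (forall v, N v <= 1 -> dotv v e <= dotv u1 e) ->
  (forall v, N v <= 1 -> dotv v e <= dotv u2 e) -> u1 = u2.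
Proof.
move=> sN e0 n1 n2 h1 h2; apply/eqP/negPn/negP => u12; apply: (sN _ _ u12).
have u12e : dotv u1 e = dotv u2 e by apply/eqP; rewrite eq_le h1 ?h2 ?n1 ?n2.
have ne0 : 0 < N e.
  rewrite lt_neqAle (norm_ge0 hN) andbT eq_sym.
  by apply: contra_neq e0 => /(norm_eq0 hN).
have h0 : 0 < dotv u1 e.
  apply: (@lt_le_trans _ _ (dotv ((N e)^-1 *: e) e)).
    by rewrite dotvZl mulr_gt0 ?invr_gt0// dotv_gt0.
  apply: h1; rewrite (normZ hN) ger0_norm ?invr_ge0 ?(ltW ne0)//.
  by rewrite mulVf// gt_eqF.
move=> _ [t tI <-]; move: tI; rewrite /= in_itv/= => /andP[t0 t1].
apply: sphere_boundary; set s := _ + _.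
have se : dotv s e = dotv u1 e by rewrite dotvDl !dotvZl -u12e; ring.
have s1 : N s <= 1.
  have := @norm_convex _ _ _ hN t u1 u2 0 t0 t1.
  by rewrite !subr0 n1 n2 -/s; lra.
apply/eqP; rewrite eq_le s1/= leNgt; apply/negP => s_lt1.
have s0 : 0 < N s.
  rewrite lt_neqAle (norm_ge0 hN) andbT eq_sym; apply/eqP => /(norm_eq0 hN) s0.
  by move: h0; rewrite -se s0 /dotv mul0mx mxE ltxx.
have := h1 ((N s)^-1 *: s).
rewrite (normZ hN) ger0_norm ?invr_ge0 ?(ltW s0)// mulVf ?gt_eqF//.
move=> /(_ (lexx _)).
by rewrite dotvZl se ler_pdivrMl// ler_pMl// leNgt s_lt1.
Qed.

Variable C : set V.
Hypothesis C0 : C !=set0.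
Hypothesis CP : forall x, C x <-> C `<=` mball N x 1.
Hypothesis sN : strictly_convex N.

(** For each diametral partner [q] of [x], the translated Euclidean ball lies in the
    unit ball and touches it at [x - q]; so [x - q] maximizes the form given by
    the Euclidean normal [x - z], and the maximizer is unique. *)
Lemma smooth_point_b_exp x z p : C x -> C p -> N (x - p) = 1 -> x != z ->
  (forall w, dotv (w - z) (w - z) <= dotv (x - z) (x - z) -> C w) ->
  b_exp N C p.
Proof.
move=> Cx Cp xp xz Cball; exists x.
  by split; [exact/CP|exists p].
have e0 : x - z != 0 by rewrite subr_eq0.
have supp q : C q -> N (x - q) = 1 ->
    forall v, N v <= 1 -> dotv v (x - z) <= dotv (x - q) (x - z).
  move=> Cq xq v v1; apply: (@tangent_support (x - z) (x - q) xq _ v v1) => w.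
  move=> /half_space_tangent[t t0 ht].
  exists t => //; suff /CP/(_ _ Cq) : C (x + t *: w).
    by rewrite /mball /closed_ball_ /= addrAC.
  by apply: Cball; rewrite addrAC.
apply/seteqP; split=> [_ ->|q [Cq xq]]; first by split.
have := @strictly_convex_support _ _ _ sN e0 xq xp (supp _ Cq xq) (supp _ Cp xp).
by move=> /addrI/oppr_inj.
Qed.

(** The point [x'] is the Euclidean nearest to [z] among those having a diametral
    partner, found by minimizing over the compact set of diametral pairs.  The
    Euclidean ball around [z] through [x'] is inside [C]: a segment from [z] to a
    point [w] of the ball outside [C] would cross such a point strictly closer. *)
Lemma inscribed_ball_b_exp z : C z -> (forall p, C p -> N (z - p) < 1) ->
  forall x y, C x -> C y -> N (x - y) = 1 ->
  exists x' p, [/\ C x', N (x' - p) = 1, b_exp N C p &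
    dotv (x' - z) (x' - z) <= dotv (x - z) (x - z)].
Proof.
move=> Cz z1 x y Cx Cy xy.
pose P := (C `*` C) `&` (fun p : V * V => N (p.1 - p.2)) @^-1` [set s | s = 1].
have cC := self_dual_compact hN C0 CP.
have cP : compact P.
  apply: compact_closedI; first exact: compact_setX.
  apply: preimage_closed; last exact: closed_eq.
  by move=> p _; exact: dist_continuous2.
have P0 : P !=set0 by exists (x, y).
pose f (p : V * V) := dotv (p.1 - z) (p.1 - z).
have fc : continuous f.
  move=> p; apply: (continuous_comp (f := fun p : V * V => p.1)
    (g := fun a : V => dotv (a - z) (a - z))).
    exact: cvg_fst.
  exact: sqr_dist_continuous.
have [[x' p]] := compact_EVT_min P0 cP (continuous_subspaceT fc).
rewrite inE => -[[/= Cx' Cp] xp] fmin.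
have {}fmin a b : C a -> C b -> N (a - b) = 1 -> f (x', p) <= f (a, b).
  by move=> Ca Cb ab; apply: fmin; rewrite inE.
exists x', p; split=> //; last exact: (fmin _ _ Cx Cy xy).
have xz : x' != z.
  by apply: contra_eq_neq xp => ->; rewrite lt_eqF// z1.
apply: (@smooth_point_b_exp x' z p Cx' Cp xp xz) => w wz; apply: contrapT => nCw.
have [t [t0 t1 Cb [q Cq bq]]] := segment_crossing hN C0 CP Cz nCw.
have := fmin _ _ Cb Cq bq; rewrite /f/=.
have -> : (1 - t) *: z + t *: w - z = t *: (w - z).
  by apply/rowP => i; rewrite !mxE; ring.
rewrite dotvZl dotvZr mulrA leNgt => /negP; apply.
have x'z0 : 0 < dotv (x' - z) (x' - z) by rewrite dotv_gt0// subr_eq0.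
rewrite (le_lt_trans (ler_wpM2l (mulr_ge0 t0 t0) wz))// gtr_pMl//.
by rewrite mulr_ilt1.
Qed.

(** Starting from [z] on the segment from [x] to a deep point [c], at ratio [s], the
    point [x'] of [inscribed_ball_b_exp] is within [O(s)] of [x], and its
    b-exposed partner has distance 1 from [x']. *)
Lemma b_exp_near_face x y (e : R) : C x -> C y -> N (x - y) = 1 -> 0 < e ->
  exists2 p, b_exp N C p & 1 - e <= N (x - p).
Proof.
move=> Cx Cy xy e0.
have [c [r [r1 cr]]] := deep_point hN C0 CP.
pose D := dotv (c - x) (c - x).
(* [s * M] bounds [N (x - x')]; [D + 1] stands in for the square root of [D] *)
pose M := N (c - x) + coord_norm_sum N * (D + 1).
have D0 : 0 <= D by exact: dotv_ge0.
have M0 : 0 <= M.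
  rewrite addr_ge0 ?(norm_ge0 hN)// mulr_ge0 ?(coord_norm_sum_ge0 hN)//.
  by rewrite addr_ge0.
have M1 : 0 < M + 1 by rewrite ltr_wpDl.
pose s := Num.min 1 (e / (M + 1)).
have s0 : 0 < s by rewrite lt_min ltr01 divr_gt0.
have s1 : s <= 1 by rewrite ge_min lexx.
have sM : s * (M + 1) <= e by rewrite -ler_pdivlMr// ge_min lexx orbT.
pose z := (1 - s) *: x + s *: c.
have z1 p : C p -> N (z - p) < 1.
  move=> Cp; have := @norm_convex _ _ _ hN s x c p (ltW s0) s1.
  have := cr _ Cp; have := self_dual_le CP Cx Cp; rewrite -/z.
  nra.
have Cz : C z by apply/CP => p /z1/ltW.
have [x' [p [Cx' xp Ep x'z]]] := inscribed_ball_b_exp Cz z1 Cx Cy xy.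
exists p => //.
have zx : z - x = s *: (c - x) by apply/rowP => i; rewrite !mxE; ring.
have x'zN : N (x' - z) <= coord_norm_sum N * (s * (D + 1)).
  apply: norm_le_coord => // i.
  have sD : 0 <= s * (D + 1) by rewrite mulr_ge0 ?(ltW s0)// addr_ge0.
  rewrite -(@ler_pXn2r _ 2)// ?nnegrE// real_normK ?num_real//.
  rewrite (le_trans (coord_sqr_le _ _))// (le_trans x'z)//.
  have -> : x - z = (- s) *: (c - x) by rewrite scaleNr -zx opprB.
  rewrite dotvZl dotvZr -/D mulrA mulrNN -expr2 exprMn ler_wpM2l ?sqr_ge0//.
  nra.
have xz : N (z - x) = s * N (c - x).
  by rewrite zx (normZ hN) ger0_norm// ltW.
have := @norm_dist_triangle _ _ _ hN z x' x.
have := @norm_dist_triangle _ _ _ hN x x' p.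
have : s * (M + 1) = s * N (c - x) + coord_norm_sum N * (s * (D + 1)) + s.
  by rewrite /M; ring.
lra.
Qed.

End Euclid.

(** * The equivalences *)

Section Equivalences.
Set Implicit Arguments.
Unset Strict Implicit.
Variables (R : realType) (n : nat) (N : 'rV[R]_n -> R).
Hypothesis hN : is_norm N.
Variables C K : set 'rV[R]_n.
Hypothesis hC : complete_set N C.
Hypothesis dC : diam N C = 1%:E.
Hypothesis KC : K `<=` C.

Let C0 : C !=set0. Proof. by case: hC. Qed.
Let CP := complete_self_dual hN hC dC.

Lemma ball_hull_of_unique_completion :
  unique_completion N K C -> ball_hull N K = C.
Proof.
move=> [[_ _ dKC] uC]; apply/ball_hull_eqP => // x Kx.
have dK : diam N K = 1%:E by rewrite -dKC.
have Kx1 a b : (K `|` [set x]) a -> (K `|` [set x]) b -> N (a - b) <= 1.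
  move=> [Ka|->] [Kb|->].
  - exact: diam1_le dK Ka Kb.
  - by rewrite (normBC hN); exact: Kx.
  - exact: Kx.
  - by rewrite subrr (norm0 hN).
have dKx : diam N (K `|` [set x]) = 1%:E.
  apply/eqP; rewrite eq_le diam_le//= -dK.
  by apply: subset_diam; exact: subsetUl.
have Kx0 : K `|` [set x] !=set0 by exists x; right.
have [A cA [KA dA]] := exists_complete_superset hN Kx0 Kx1 dKx.
rewrite -(uC A); first by apply: KA; right.
by split=> [//|a Ka|]; [apply: KA; left|rewrite dA dK].
Qed.

(** Both ends of a diametral pair of [C] can be moved into [K], one at a time. *)
Lemma diam1_of_partners : diametral_partners N C K -> diam N K = 1%:E.
Proof.
move=> Kp.
have [x [y [Cx Cy xy]]] := exists_diametral_pair hN C0 CP dC.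
have [k Kk xk] := Kp _ _ Cx Cy xy.
rewrite (normBC hN) in xk.
have [l Kl kl] := Kp _ _ (KC Kk) Cx xk.
apply: (diam_eq _ Kk Kl kl) => a b /KC Ca /KC Cb.
exact: (self_dual_le CP Ca Cb).
Qed.

Lemma unique_completion_of_ball_hull :
  diam N K = 1%:E -> ball_hull N K = C -> unique_completion N K C.
Proof.
move=> dK /(ball_hull_eqP hN CP KC) KE.
split=> [|A [cA KA dAK]]; first by split=> //; rewrite dC dK.
have AP := complete_self_dual hN cA (etrans dAK dK).
have AC : A `<=` C.
  by move=> x Ax; apply: KE => k /KA Ak; exact: (self_dual_le AP Ax Ak).
apply/seteqP; split=> // x Cx; apply/AP => a /AC Ca.
exact: (self_dual_le CP Cx Ca).
Qed.

Lemma b_exp_hull_of_partners : convex_body K -> diametral_partners N C K ->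
  closure (conv_hull (b_exp N C)) `<=` K.
Proof.
move=> [cK vK _] /(meets_faces_partners CP KC) KF.
rewrite closureE; apply: smallest_sub.
  by apply: compact_closed cK; exact: norm_hausdorff.
by apply: smallest_sub => // p /KF[k [Kk /= <-]].
Qed.

Lemma partners_of_b_exp : strictly_convex N -> compact K -> K !=set0 ->
  b_exp N C `<=` K -> diametral_partners N C K.
Proof.
move=> sN cK K0 EK x y Cx Cy xy.
have [k Kk kmax] := @farthest_point _ _ _ hN _ x cK K0.
exists k => //; apply/eqP; rewrite eq_le (self_dual_le CP Cx (KC Kk))/=.
rewrite leNgt; apply/negP => k1.
have e0 : 0 < (1 - N (x - k)) / 2 by rewrite divr_gt0// subr_gt0.
have [p Ep] := b_exp_near_face hN C0 CP sN Cx Cy xy e0.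
have := kmax p (EK _ Ep).
lra.
Qed.

End Equivalences.

Theorem proposition4 (R : realType) (n : nat) (hn : (0 < n)%N)
    (N : 'rV[R]_n -> R) (hN : is_norm N) (C K : set 'rV[R]_n)
    (hC : complete_set N C) (hdC : diam N C = 1%:E)
    (hK : convex_body K) (hKC : K `<=` C) :
  [/\ unique_completion N K C <-> ball_hull N K = C,
      ball_hull N K = C <->
        (forall F : set 'rV[R]_n, exposed_bface N C F -> K `&` F !=set0) &
      strictly_convex N ->
        ((forall F : set 'rV[R]_n, exposed_bface N C F -> K `&` F !=set0) <->
          closure (conv_hull (b_exp N C)) `<=` K)].
Proof.
have CP := complete_self_dual hN hC hdC.
have C0 : C !=set0 by case: hC.
have [cK _ K0] := hK.
have II_III : ball_hull N K = C <-> diametral_partners N C K.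
  by split; [exact: partners_of_ball_hull|exact: ball_hull_of_partners].
have III := meets_faces_partners CP hKC.
split.
- split=> [|KE]; first exact: ball_hull_of_unique_completion.
  apply: (unique_completion_of_ball_hull hN hC hdC hKC _ KE).
  by apply: (diam1_of_partners hN hC hdC hKC); exact/II_III.
- by rewrite II_III; exact: iff_sym.
- move=> sN; rewrite III; split=> [|EK].
    exact: (b_exp_hull_of_partners hN hC hdC hKC hK).
  apply: (partners_of_b_exp hN hC hdC hKC sN cK K0) => p Ep.
  exact: (EK _ (subset_closure (sub_gen_smallest Ep))).
Qed.
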